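(* There exist $2^{\aleph_0}$ path-minimal prime graphs whose ages are pairwise incomparable with respect to set inclusion and each well-quasi-ordered under embeddability.
   Context: Graphs are simple, undirected, loopless. A graph embeds in another if it is isomorphic to an induced subgraph. The age of a graph is the class of finite graphs embedding in it; it is well-quasi-ordered if it contains no infinite antichain. A path is a graph whose vertices can be injectively mapped into an interval of $\mathbb{Z}$ so that adjacency means images differing by $1$; its length is its number of vertices minus one. A graph $G$ is path-minimal if for every $n$ it has an induced subgraph which is a finite path of length at least $n$, and every induced subgraph of $G$ with this property embeds $G$. A module of $G=(V,E)$ is a set $A\subseteq V$ such that every $v\notin A$ is adjacent to all or to none of the vertices of $A$; $\emptyset$, singletons and $V$ are trivial modules. $G$ is prime if it has more than three vertices and all its modules are trivial. *)

(* Defs.v *)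
From mathcomp Require Import all_boot all_order all_algebra.
From mathcomp Require Import boolp classical_sets functions cardinality.

Set Implicit Arguments.
Unset Strict Implicit.
Unset Printing Implicit Defensive.

Local Open Scope classical_set_scope.
Local Open Scope card_scope.

Record graph := Graph {
  vertex : Type;
  adj : vertex -> vertex -> Prop;
  adj_sym : forall u v, adj u v -> adj v u;
  adj_irrefl : forall u, ~ adj u u
}.

(* The vertex type is a plain sig type rather than set_type A: the latter lives
   in the universe of set, which would preclude forming set graph below. *)
Definition induced (G : graph) (A : set (vertex G)) : graph :=
  @Graph {x : vertex G | A x} (fun u v => adj (sval u) (sval v))
    (fun u v => @adj_sym G (sval u) (sval v))
    (fun u => @adj_irrefl G (sval u)).

Definition isomorphic (G H : graph) : Prop :=
  exists f : vertex G -> vertex H,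
    bijective f /\ forall u v, adj u v <-> adj (f u) (f v).

Definition embeds (H G : graph) : Prop :=
  exists A : set (vertex G), isomorphic H (induced A).

Definition finite_graph (G : graph) : Prop := finite_set [set: vertex G].

Definition age (G : graph) : set graph :=
  [set H | finite_graph H /\ embeds H G].

Definition wqo (C : set graph) : Prop :=
  ~ exists F : nat -> graph,
      (forall n, C (F n)) /\ (forall i j, i <> j -> ~ embeds (F i) (F j)).

Definition int_interval (I : set int) : Prop :=
  forall a b c : int, I a -> I b -> (a <= c <= b)%R -> I c.

(* The vertices fill up an interval of the integers: allowing f to skip values
   would make disjoint unions of paths (e.g. edgeless graphs) into paths. *)
Definition is_path (P : graph) : Prop :=
  exists f : vertex P -> int,
    [/\ injective f, int_interval (range f) &
        forall u v, adj u v <-> `|f u - f v|%R = 1%R].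

Definition finite_path_of_length (P : graph) (l : nat) : Prop :=
  is_path P /\ [set: vertex P] #= `I_l.+1.

Definition has_long_paths (G : graph) : Prop :=
  forall n : nat, exists (A : set (vertex G)) (l : nat),
    (n <= l)%N /\ finite_path_of_length (induced A) l.

Definition path_minimal (G : graph) : Prop :=
  has_long_paths G /\
  forall A : set (vertex G), has_long_paths (induced A) -> embeds G (induced A).

Definition is_module (G : graph) (A : set (vertex G)) : Prop :=
  forall v, ~ A v ->
    (forall a, A a -> adj v a) \/ (forall a, A a -> ~ adj v a).

Definition trivial_module (G : graph) (A : set (vertex G)) : Prop :=
  [\/ A = set0, exists x, A = [set x] | A = setT].

Definition prime_graph (G : graph) : Prop :=
  `I_4 #<= [set: vertex G] /\
  forall A : set (vertex G), is_module A -> trivial_module A.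

(* Main.v *)
Require Import Defs.
From mathcomp Require Import all_boot.
From mathcomp Require Import order ssralg ssrnum ssrint.
From mathcomp Require Import boolp classical_sets functions cardinality.
From mathcomp Require Import zify.

Set Implicit Arguments.
Unset Strict Implicit.
Unset Printing Implicit Defensive.

Local Open Scope classical_set_scope.
Local Open Scope card_scope.

(** For a binary word [u], take disjoint paths labelled by longer and longer
    prefixes of [u], and join every two vertices labelled 1 that lie in different
    paths ("blocks"). A long induced path of this graph has a long run inside a
    single block: the vertices of a path that are labelled 1 and lie in different
    blocks are few. If [u] is uniformly recurrent, such runs contain long prefixes of
    [u], which gives path-minimality; moreover the factors of [u] are
    well-quasi-ordered by the factor relation, and two applications of Higman's lemma
    (blocks as sequences of factors, finite subgraphs as sequences of blocks) show
    that the age is well-quasi-ordered.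

    Conversely, two blocks determine their labels on a long run, up to reversal, so an
    inclusion between ages forces long common factors up to reversal. The words are
    the Toeplitz words [u n = x (logn 2 n.+1)]: every window of length [2 ^ K] has as
    many ones as the number with binary digits [x 0 ... x K.-1], up to one more, so
    that distinct suitable digit sequences [x] give words without long common
    factors. Since the digits [x 0 = 0] and [x 1 = 1] are fixed, every 1 in [u] has a 0
    just before it, whence primality. *)

(** * Well-quasi-orders and Higman's lemma *)

Definition good (T : Type) (le : T -> T -> Prop) : Prop :=
  forall f : nat -> T, exists i j, i < j /\ le (f i) (f j).

Definition transitive_rel (T : Type) (le : T -> T -> Prop) : Prop :=
  forall x y z, le x y -> le y z -> le x z.

Lemma increasing_choice (P : nat -> nat -> Prop) :
  (forall n N, exists2 m, N <= m & P n m) ->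
  exists g : nat -> nat, (forall i j, i < j -> g i < g j) /\ forall i, P i (g i).
Proof.
move=> hP.
have /choice[c hc] : forall nN : nat * nat, exists m, nN.2 <= m /\ P nN.1 m.
  by move=> [n N]; have [m] := hP n N; exists m.
pose g := fix g n := if n is n'.+1 then c (n, (g n').+1) else c (0, 0).
exists g; split; last by case=> [|i]; apply: (hc (_, _)).2.
move=> i; elim=> // j IH; rewrite ltnS leq_eqVlt => /orP[/eqP <-|/IH h].
  exact: (hc (_, _)).1.
exact: ltn_trans h (hc (_, _)).1.
Qed.

(** Infinitely many terminal indices, those with no larger term after them, would form a bad
    sequence; beyond the last one, every term has a later term above it. *)
Lemma monotone_subsequence (T : Type) (le : T -> T -> Prop) (f : nat -> T) :
  good le -> transitive_rel le ->
  exists g : nat -> nat, (forall i j, i < j -> g i < g j) /\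
    forall i j, i < j -> le (f (g i)) (f (g j)).
Proof.
move=> hgood htr.
pose terminal n := forall m, n < m -> ~ le (f n) (f m).
have [N hN] : exists N, forall n, N <= n -> ~ terminal n.
  apply: contrapT => hno.
  have [|g [gmono gterm]] := @increasing_choice (fun=> terminal).
    move=> _ N; apply: contrapT => hN; apply: hno; exists N => n len tn.
    by apply: hN; exists n.
  have [i [j [ltij hle]]] := hgood (f \o g).
  exact: gterm (gmono _ _ ltij) hle.
have /choice[c hc] : forall n, exists m, N <= n -> n < m /\ le (f n) (f m).
  move=> n; have [len|_] := leqP N n; last by exists 0.
  have /existsNP[m /not_implyP[ltnm /contrapT lenm]] := hN n len.
  by exists m.
pose g := fix g n := if n is n'.+1 then c (g n') else N.
have gN n : N <= g n.
  by elim: n => //= n IH; apply: leq_trans IH (ltnW (hc _ IH).1).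
exists g; split=> i; elim=> // j IH; rewrite ltnS leq_eqVlt => /orP[/eqP <-|/IH h].
- exact: (hc _ (gN i)).1.
- exact: ltn_trans h (hc _ (gN j)).1.
- exact: (hc _ (gN i)).2.
- exact: htr h (hc _ (gN j)).2.
Qed.

Lemma minimal_bad_sequence (T : Type) (size : T -> nat) (le : T -> T -> Prop) :
  ~ good le ->
  exists f : nat -> T, (forall i j, i < j -> ~ le (f i) (f j)) /\
    forall (g : nat -> T) n, (forall i, i < n -> g i = f i) ->
      size (g n) < size (f n) -> exists i j, i < j /\ le (g i) (g j).
Proof.
move=> /existsNP[f0 hf0].
pose bad (f : nat -> T) := forall i j, i < j -> ~ le (f i) (f j).
have bad0 : bad f0 by move=> i j ij h; apply: hf0; exists i, j.
have /choice[step hstep] : forall nf : nat * (nat -> T), exists f' : nat -> T,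
    bad nf.2 -> [/\ bad f', forall i, i < nf.1 -> f' i = nf.2 i &
      forall g, bad g -> (forall i, i < nf.1 -> g i = nf.2 i) ->
        size (f' nf.1) <= size (g nf.1)].
  move=> [n f] /=; have [bf|] := pselect (bad f); last by exists f.
  pose P k := `[< exists g, [/\ bad g, forall i, i < n -> g i = f i &
                            size (g n) = k] >].
  have exP : exists k, P k by exists (size (f n)); apply/asboolP; exists f.
  case: (ex_minnP exP) => k /asboolP[g [bg gf <-]] hmin.
  exists g => _; split=> // h bh hf; apply: hmin.
  by apply/asboolP; exists h.
(* The first [n] terms of [F n] are final: each step minimises the next one among the bad sequences
   with that beginning. The diagonal is the minimal bad sequence. *)
pose F := fix F n := if n is n'.+1 then step (n', F n') else f0.
have badF n : bad (F n) by elim: n => //= n IH; case: (hstep (n, F n) IH).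
have Fstep n i : i < n -> F n.+1 i = F n i.
  by move=> h; case: (hstep (n, F n) (badF n)) => _ /(_ i h).
have Fdiag m i : i < m -> F m i = F i.+1 i.
  elim: m => // m IH; rewrite ltnS leq_eqVlt => /orP[/eqP -> //|lim].
  by rewrite Fstep // IH.
exists (fun n => F n.+1 n); split=> [i j ij|g n gF ltg].
  by rewrite -(Fdiag j.+1 i) ?ltnS ?(ltnW ij)//; apply: (badF j.+1).
apply: contrapT => hbad.
have bg : bad g by move=> i j ij h; apply: hbad; exists i, j.
case: (hstep (n, F n) (badF n)) => _ _ /(_ g bg) h.
move: ltg; rewrite ltnNge h // => i lin.
by rewrite gF //= (Fdiag n).
Qed.

(** Positions may be permuted, since adjacency depends neither on the order of the blocks nor on
    that of the intervals within a block. *)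
Definition seq_le (T : Type) (d : T) (le : T -> T -> Prop) (s t : seq T) : Prop :=
  exists phi : nat -> nat,
    (forall i, i < size s -> phi i < size t /\ le (nth d s i) (nth d t (phi i))) /\
    (forall i j, i < size s -> j < size s -> phi i = phi j -> i = j).

Lemma seq_le_trans (T : Type) (d : T) (le : T -> T -> Prop) :
  transitive_rel le -> transitive_rel (seq_le d le).
Proof.
move=> htr s t w [f [hf injf]] [g [hg injg]]; exists (g \o f); split.
  move=> i /hf[h1 h2]; have [h3 h4] := hg _ h1.
  by split=> //; apply: htr h2 h4.
move=> i j hi hj /= e; apply: injf => //.
by apply: injg => //; [apply: (hf _ hi).1 | apply: (hf _ hj).1].
Qed.

Lemma seq_le_nil (T : Type) (d : T) (le : T -> T -> Prop) s : seq_le d le [::] s.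
Proof. by exists id. Qed.

Lemma seq_le_consr (T : Type) (d : T) (le : T -> T -> Prop) s t y :
  seq_le d le s t -> seq_le d le s (y :: t).
Proof.
move=> [f [hf injf]]; exists (S \o f); split=> [i /hf //|i j hi hj [] /injf].
exact.
Qed.

Lemma seq_le_cons (T : Type) (d : T) (le : T -> T -> Prop) s t x y :
  le x y -> seq_le d le s t -> seq_le d le (x :: s) (y :: t).
Proof.
move=> lexy [f [hf injf]].
exists (fun i => if i is i'.+1 then (f i').+1 else 0); split.
  by case=> [|i] //= /hf.
by case=> [|i] [|j] //= hi hj [] /injf -> .
Qed.

(** Nash-Williams' argument: in a minimal bad sequence [f], choose a subsequence [g] with increasing
    heads and replace the terms from [g 0] on by the tails along [g]. By minimality this has a good
    pair, which lifts to [f]. *)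
Lemma higman (T : Type) (d : T) (le : T -> T -> Prop) :
  good le -> transitive_rel le -> good (seq_le d le).
Proof.
move=> hgood htr; apply: contrapT => hbad.
have [f [badf minf]] := minimal_bad_sequence size hbad.
have fE n : f n = head d (f n) :: behead (f n).
  case E: (f n) => [|//]; exfalso.
  by apply: (badf n n.+1) => //; rewrite E; apply: seq_le_nil.
have [g [gmono hg]] := monotone_subsequence (fun n => head d (f n)) hgood htr.
have gge i : g 0 <= g i by case: i => // i; apply: ltnW; apply: gmono.
pose h n := if n < g 0 then f n else behead (f (g (n - g 0))).
have [| |i [j [ltij]]] := minf h (g 0).
- by move=> i ltig; rewrite /h ltig.
- by rewrite /h ltnn subnn [in X in _ < X]fE.
rewrite /h; case: (ltnP i) => hi; case: (ltnP j) => hj hle.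
- exact: badf hle.
- apply: (badf i (g (j - g 0))); first exact: leq_trans hi (gge _).
  by rewrite (fE (g _)); apply: seq_le_consr.
- by move: (leq_ltn_trans hi ltij); rewrite ltnNge ltnW.
- have lt2 : i - g 0 < j - g 0 by rewrite ltn_sub2r // (leq_ltn_trans hi).
  apply: (badf _ _ (gmono _ _ lt2)).
  by rewrite (fE (g (i - g 0))) (fE (g (j - g 0))); apply: seq_le_cons => //; apply: hg.
Qed.

(** * Toeplitz words *)

Definition toeplitz (x : nat -> bool) (n : nat) : bool := x (logn 2 n.+1).

Lemma toeplitz_even x n : toeplitz x n.*2 = x 0.
Proof.
rewrite /toeplitz; congr x; apply/eqP.
by rewrite -leqn0 leqNgt logn_gt0 mem_primes /= dvdn2 /= odd_double.
Qed.

Lemma toeplitz_odd x n : toeplitz x n.*2.+1 = toeplitz (x \o S) n.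
Proof.
rewrite /toeplitz /=; congr x.
by rewrite -doubleS -mul2n lognM // (pfactorK 1).
Qed.

(** Adding a multiple of [2 ^ k] to [i.+1 < 2 ^ k] does not change its 2-adic valuation. *)
Lemma toeplitz_prefix x k a i :
  i.+1 < 2 ^ k -> toeplitz x (a * 2 ^ k + i) = toeplitz x i.
Proof.
elim: k x a i => [|k IH] x a i; first by rewrite expn0.
rewrite -(odd_double_half i) expnS => lti.
have -> : a * (2 * 2 ^ k) = (a * 2 ^ k).*2 by rewrite -mul2n mulnCA.
case: (odd i) lti => lti.
  rewrite add1n addnS -doubleD !toeplitz_odd IH //; lia.
by rewrite !add0n -doubleD !toeplitz_even.
Qed.

Lemma aligned_position (k c : nat) :
  exists a, c <= a * 2 ^ k /\ a * 2 ^ k + 2 ^ k <= c + 2 ^ k.+1.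
Proof.
have hpos : 0 < 2 ^ k by rewrite expn_gt0.
exists (c %/ 2 ^ k).+1.
have := divn_eq c (2 ^ k); have := ltn_pmod c hpos.
rewrite mulSn expnS; nia.
Qed.

Lemma toeplitz_recurrence x k c :
  exists2 t, c <= t /\ t + 2 ^ k <= c + 2 ^ k.+1 &
    forall i, i.+1 < 2 ^ k -> toeplitz x (t + i) = toeplitz x i.
Proof.
have [a ha] := aligned_position k c.
by exists (a * 2 ^ k) => // i; apply: toeplitz_prefix.
Qed.

Definition ones (u : nat -> bool) (p n : nat) : nat := \sum_(i < n) u (p + i).

(** Half of the window consists of even positions, all carrying [x 0]; the odd positions read a
    window of the Toeplitz word of the shifted digits. *)
Lemma ones_toeplitz_double x p n :
  ones (toeplitz x) p n.*2 = n * x 0 + ones (toeplitz (x \o S)) p./2 n.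
Proof.
elim: n => [|n IH]; first by rewrite /ones !big_ord0.
rewrite /ones doubleS !big_ord_recr /= -/(ones _ _ _) IH /ones mulSn.
have [pE|pE] : p = p./2.*2 \/ p = p./2.*2.+1.
  by have := odd_double_half p; case: (odd p); [right|left]; lia.
- have -> : p + n.*2 = (p./2 + n).*2 by lia.
  have -> : p + n.*2.+1 = (p./2 + n).*2.+1 by lia.
  by rewrite toeplitz_even toeplitz_odd; move: (\sum_(i < n) _) (n * _); lia.
- have -> : p + n.*2 = (p./2 + n).*2.+1 by lia.
  have -> : p + n.*2.+1 = (p./2 + n).+1.*2 by lia.
  by rewrite toeplitz_even toeplitz_odd; move: (\sum_(i < n) _) (n * _); lia.
Qed.

(* [prefix_value x K] is the integer with binary digits [x 0, ..., x K.-1],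
   most significant first. *)
Fixpoint prefix_value (x : nat -> bool) (K : nat) : nat :=
  if K is K'.+1 then 2 ^ K' * x 0 + prefix_value (x \o S) K' else 0.

(** Halving the window down to length one leaves a single unknown letter, which accounts for the
    error of one. *)
Lemma ones_toeplitz x p K :
  prefix_value x K <= ones (toeplitz x) p (2 ^ K) <= (prefix_value x K).+1.
Proof.
elim: K x p => [|K IH] x p /=.
  by rewrite /ones expn0 big_ord_recl big_ord0; case: toeplitz.
rewrite expnS mul2n ones_toeplitz_double.
by have := IH (x \o S) p./2; lia.
Qed.

(** Among [k + 3] digits, digit [k] has weight 4, while [y] has at most 1 left after it. A gap of
    two beats the error of one in [ones_toeplitz]. *)
Lemma prefix_value_gap (x y : nat -> bool) k :
  (forall i, i < k -> x i = y i) -> x k -> ~~ y k -> ~~ y k.+1 ->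
  prefix_value y (k + 3) + 2 <= prefix_value x (k + 3).
Proof.
elim: k x y => [|k IH] x y xy xk yk yk1.
  by rewrite /= xk (negbTE yk) (negbTE yk1); case: (y 2); lia.
have gap := IH (x \o S) (y \o S) (fun i h => xy i.+1 h) xk yk yk1.
by rewrite addSn /= xy // -addnA leq_add2l.
Qed.

Lemma toeplitz_ones_inj (x y : nat -> bool) k p q :
  (forall i, i < k -> x i = y i) -> x k <> y k -> ~~ x k.+1 -> ~~ y k.+1 ->
  ones (toeplitz x) p (2 ^ (k + 3)) <> ones (toeplitz y) q (2 ^ (k + 3)).
Proof.
move=> xy xyk xk1 yk1.
have := ones_toeplitz x p (k + 3); have := ones_toeplitz y q (k + 3).
case xk: (x k); case yk: (y k); rewrite ?xk ?yk // in xyk.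
  by have := @prefix_value_gap x y k xy xk (negbT yk) yk1; lia.
have yx i (h : i < k) : y i = x i by rewrite xy.
by have := @prefix_value_gap y x k yx yk (negbT xk) xk1; lia.
Qed.

Lemma ones_rev (u : nat -> bool) c n :
  \sum_(i < n) u (c + n.-1 - i) = ones u c n.
Proof.
rewrite /ones (reindex_inj rev_ord_inj) /=; apply: eq_bigr => i _.
by congr (nat_of_bool (u _)); have := ltn_ord i; lia.
Qed.

(* A pair [(a, k)] stands for the factor of length [k] of [u] at position [a]. *)
Definition factor_le (u : nat -> bool) (v w : nat * nat) : Prop :=
  exists2 t, t + v.2 <= w.2 & forall i, i < v.2 -> u (v.1 + i) = u (w.1 + t + i).

Lemma factor_le_trans u : transitive_rel (factor_le u).
Proof.
move=> v w z [t ht htu] [t' ht' htu']; exists (t' + t); first by lia.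
move=> i lti; rewrite htu // -addnA htu'; last by lia.
by congr u; lia.
Qed.

(* By uniform recurrence, a factor that does not contain the first one has
   bounded length, and there are finitely many words of bounded length. *)
Lemma factor_le_good x : good (factor_le (toeplitz x)).
Proof.
move=> f; set u := toeplitz x.
(* The first factor lies in the prefix of length [2 ^ K - 1], which recurs in every window of length
   [2 ^ K.+1]. *)
pose K := (f 0).1 + (f 0).2 + 1.
have Klt : K < 2 ^ K by apply: ltn_expl.
have [[j [j0 hj]]|hshort] := pselect (exists j, 0 < j /\ 2 ^ K.+1 <= (f j).2).
  exists 0, j; split=> //.
  have [t [ht1 ht2] htu] := toeplitz_recurrence x K (f j).1.
  exists (t - (f j).1 + (f 0).1); first by lia.
  move=> i lti; rewrite /u -htu; last by lia.
  by congr toeplitz; lia.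
pose B := 2 ^ K.+1.
(* Pigeonhole on the next [B] letters and the length. Index 0 is skipped below because only later
   factors are known to be shorter than [B]. *)
pose code (j : nat) : {ffun 'I_B -> bool} * 'I_B.+1 :=
  ([ffun i : 'I_B => u ((f j).1 + i)], inord (f j).2).
pose T : finType := ({ffun 'I_B -> bool} * 'I_B.+1)%type.
have ninj : ~ injective (fun j : 'I_#|T|.+1 => code j.+1).
  by move=> /leq_card; rewrite card_ord ltnn.
have {ninj} [i [j [ltij eqc]]] : exists i j, i < j /\ code i.+1 = code j.+1.
  apply: contrapT => hno; apply: ninj => i j eqc; apply/val_inj => /=.
  by case: (ltngtP i j) => // h; exfalso; apply: hno;
    [exists i, j | exists j, i].
exists i.+1, j.+1; split=> //.
have short n : (f n.+1).2 < B.
  by rewrite ltnNge; apply/negP => h; apply: hshort; exists n.+1.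
case: eqc => eqf /(congr1 val) /=; rewrite !inordK ?ltnS ?(ltnW (short _))// => eqk.
exists 0; first by rewrite add0n eqk.
move=> r ltr; rewrite addn0.
have ltrB : r < B by apply: ltn_trans ltr (short i).
by move/ffunP/(_ (Ordinal ltrB)): eqf; rewrite !ffunE.
Qed.

(** * Embeddings and induced paths *)

Definition embedding (G H : graph) (f : vertex G -> vertex H) : Prop :=
  injective f /\ forall u v, adj u v <-> adj (f u) (f v).

Lemma sval_injective (T : Type) (A : T -> Prop) : injective (@sval T A).
Proof. by move=> [x hx] [y hy] /= e; subst y; congr exist; apply: Prop_irrelevance. Qed.

Lemma surjective_bijective (T U : Type) (f : T -> U) :
  injective f -> (forall y, exists x, f x = y) -> bijective f.
Proof.
move=> injf /choice[g gK]; exists g => // x.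
by apply: injf; rewrite gK.
Qed.

Lemma embedsP (H G : graph) :
  embeds H G <-> exists f : vertex H -> vertex G, embedding f.
Proof.
split=> [[A [g [/bij_inj injg gadj]]]|[f [injf fadj]]].
  by exists (fun v => sval (g v)); split=> // u v /sval_injective /injg.
pose A := [set f v | v in [set: vertex H]].
pose g (v : vertex H) : vertex (induced A) := exist _ (f v) (imageT f v).
exists A, g; split=> //; apply: surjective_bijective.
  by move=> u v /(congr1 sval) /injf.
by move=> [y hy]; have [x _ fx] := hy; exists x; apply: sval_injective.
Qed.

Lemma embedding_induced (G : graph) (A : set (vertex G)) :
  embedding (fun v : vertex (induced A) => sval v).
Proof. by split=> //; apply: sval_injective. Qed.

Lemma embedding_comp (G H K : graph) (f : vertex G -> vertex H)
  (g : vertex H -> vertex K) : embedding f -> embedding g -> embedding (g \o f).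
Proof.
move=> [injf fadj] [injg gadj]; split; first exact: inj_comp.
by move=> u v; apply: (iff_trans (fadj u v)).
Qed.

Definition near (i j : nat) : bool := (i.+1 == j) || (j.+1 == i).

Lemma nearDl c i j : near (c + i) (c + j) = near i j.
Proof. by rewrite /near -!addnS !eqn_add2l. Qed.

Definition induced_path (G : graph) (n : nat) (p : nat -> vertex G) : Prop :=
  forall i j, i < n -> j < n ->
    (p i = p j -> i = j) /\ (adj (p i) (p j) <-> near i j).

Lemma induced_path_embedding (G H : graph) n (p : nat -> vertex G)
    (f : vertex G -> vertex H) :
  embedding f -> induced_path n p -> induced_path n (f \o p).
Proof.
move=> [injf fadj] hp i j hi hj; have [h1 h2] := hp i j hi hj.
split=> [/injf //|]; apply: iff_trans h2; apply: iff_sym; exact: fadj.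
Qed.

Lemma induced_path_le (G : graph) m n (p : nat -> vertex G) :
  m <= n -> induced_path n p -> induced_path m p.
Proof. by move=> lemn hp i j hi hj; apply: hp; apply: leq_trans lemn. Qed.

(** With [a] the least value of [f], the [l.+1] distinct values cannot all lie below [a + l], so the
    interval contains [a, ..., a + l]; [p i] is a preimage of [a + i]. *)
Lemma finite_path_induced_path (P : graph) (l : nat) :
  finite_path_of_length P l -> exists p : nat -> vertex P, induced_path l.+1 p.
Proof.
move=> [[f [injf itv fadj]]].
move=> /card_set_bijP[h [hlt hinj hsurj]].
have /choice[g gK] : forall i : 'I_l.+1, exists v, h v = i.
  by move=> i; have [v _ <-] := hsurj i (ltn_ord i); exists v.
have ginj : injective g by move=> i j e; apply: val_inj; rewrite /= -!gK e.
have gsurj v : exists i, g i = v.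
  by exists (Ordinal (hlt v I)); apply: hinj; rewrite ?in_setT ?gK.
pose i0 := [arg min_(i < ord0 : 'I_l.+1) f (g i)]%O.
have hmin v : (f (g i0) <= f v)%R.
  have [j <-] := gsurj v; rewrite /i0.
  by case: Order.TotalTheory.arg_minP => // k _; apply.
set a := f (g i0) in hmin.
have [v hv] : exists v, (a + l%:Z <= f v)%R.
  apply: contrapT => hno.
  have lt v : `|f v - a|%N < l.
    have := hmin v; have : ~ (a + l%:Z <= f v)%R by move=> hv; apply: hno; exists v.
    by lia.
  have /leq_card : injective (fun i : 'I_l.+1 => Ordinal (lt (g i))).
    move=> i j /(congr1 val) /= e; apply/ginj/injf.
    by have := hmin (g i); have := hmin (g j); lia.
  by rewrite !card_ord ltnn.
have /choice[p hp] : forall i : nat, exists w, i < l.+1 -> f w = (a + i%:Z)%R.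
  move=> i; have [lti|] := ltnP i l.+1; last by exists v.
  have [|w _ hw] := itv a (f v) (a + i%:Z)%R (imageT f _) (imageT f v).
    by lia.
  by exists w.
exists p => i j hi hj; split=> [e|].
  by have := hp i hi; rewrite e hp //; lia.
by rewrite fadj !hp // /near; split; lia.
Qed.

Lemma induced_path_finite_path (G : graph) (l : nat) (p : nat -> vertex G) :
  induced_path l.+1 p ->
  finite_path_of_length (induced (p @` `I_l.+1)) l.
Proof.
move=> hp; set A := p @` `I_l.+1.
have /choice[f hf] : forall v : vertex (induced A),
    exists i : nat, i < l.+1 /\ p i = sval v.
  by move=> [v [i lti e]]; exists i.
have finj : injective f.
  by move=> u v e; apply: sval_injective; rewrite -(hf u).2 -(hf v).2 e.
have fsurj i : i < l.+1 -> exists v, f v = i.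
  move=> lti; have Ai : A (p i) by exists i.
  exists (exist _ (p i) Ai); have [h1 h2] := hf (exist _ (p i) Ai).
  exact: (hp _ _ h1 lti).1.
split.
  exists (fun v => Posz (f v)); split.
  - by move=> u v [] /finj.
  - move=> _ _ c [u _ <-] [v _ <-] hc.
    have [|w hw] := fsurj `|c|%N; first by have := (hf v).1; lia.
    by exists w => //; rewrite hw; lia.
  - move=> u v; have [h1 e1] := hf u; have [h2 e2] := hf v.
    rewrite /= -e1 -e2 (hp _ _ h1 h2).2 /near; split; lia.
apply/card_set_bijP; exists f; split.
- by move=> v _; apply: (hf v).1.
- by move=> u v _ _; apply: finj.
- by move=> i /fsurj[v <-]; exists v.
Qed.

Lemma has_long_pathsP (G : graph) :
  has_long_paths G <-> forall n, exists p : nat -> vertex G, induced_path n p.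
Proof.
split=> hG n.
  have [A [l [lenl /finite_path_induced_path[p hp]]]] := hG n.
  exists (fun i => sval (p i)).
  apply: (@induced_path_le _ n l.+1); first exact: leqW.
  exact: (induced_path_embedding (embedding_induced A) hp).
have [p hp] := hG n.+1.
by exists (p @` `I_n.+1), n; split=> //; apply: induced_path_finite_path.
Qed.

(** * The graph of a word *)

(** The pair [(b, i)] is the vertex at position [i] of block [b], labelled [u i]. *)
Definition block_adj (u : nat -> bool) (p q : nat * nat) : bool :=
  if p.1 == q.1 then near p.2 q.2 else u p.2 && u q.2.

Lemma block_adj_sym u p q : block_adj u p q -> block_adj u q p.
Proof.
rewrite /block_adj eq_sym; case: eqP => _; last by rewrite andbC.
by rewrite /near orbC.
Qed.

Lemma block_adj_irrefl u p : ~ block_adj u p p.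
Proof. by rewrite /block_adj eqxx /near; lia. Qed.

Definition block_graph (u : nat -> bool) : graph :=
  @Graph (nat * nat) (fun p q => block_adj u p q)
    (@block_adj_sym u) (@block_adj_irrefl u).

(* The disjoint union of the paths labelled by the prefixes of [u] of length at
   least 6, with all edges added between vertices labelled 1 in distinct paths. *)
Definition word_graph (u : nat -> bool) : graph :=
  @induced (block_graph u) [set p | p.2 < p.1 + 6].

Lemma near_monotone (q : nat -> nat) (n : nat) :
  (forall i, i.+1 < n -> near (q i) (q i.+1)) ->
  (forall i j, i < n -> j < n -> q i = q j -> i = j) ->
  exists c, (forall i, i < n -> q i = c + i) \/
            (forall i, i < n -> q i = c + n.-1 - i).
Proof.
case: n => [|[|n]] hq injq; first by exists 0; left.
  by exists (q 0); left=> -[|//]; rewrite addn0.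
have step i : i.+2 < n.+2 ->
    [/\ near (q i) (q i.+1), near (q i.+1) (q i.+2) & q i != q i.+2].
  move=> lti; split; [by apply: hq; lia | by apply: hq; lia |].
  by apply/eqP => /injq; lia.
have [up|down] : q 1 = (q 0).+1 \/ q 0 = (q 1).+1.
  by have := hq 0; rewrite /near; lia.
- have h i : i.+1 < n.+2 -> q i = q 0 + i /\ q i.+1 = q 0 + i.+1.
    elim: i => [|i IH] lti; first by lia.
    have [|h1 h2] := IH; first by lia.
    by have [] := step i lti; rewrite /near; lia.
  by exists (q 0); left=> -[|i] lti; [lia | apply: (h i lti).2].
- have h i : i.+1 < n.+2 -> q 0 = q i + i /\ q 0 = q i.+1 + i.+1.
    elim: i => [|i IH] lti; first by lia.
    have [|h1 h2] := IH; first by lia.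
    by have [] := step i lti; rewrite /near; lia.
  exists (q n.+1); right=> -[|i] lti; have := (h n (ltnSn _)).2 => /=; first by lia.
  by have := (h i lti).2; lia.
Qed.

Lemma locally_constant (T : Type) (g : nat -> T) (s n : nat) :
  (forall i, i.+1 < n -> g (s + i).+1 = g (s + i)) ->
  forall i, i < n -> g (s + i) = g s.
Proof.
move=> hg; elim=> [|i IH] lti; first by rewrite addn0.
by rewrite addnS hg // IH // ltnW.
Qed.

(* If consecutive vertices [p i] and [p i.+1] lie in different blocks, they are
   labelled 1, and a vertex labelled 1 further along the path would have to lie in
   both blocks; so the path stays in one block from then on. *)
Lemma induced_path_run u n (p : nat -> vertex (block_graph u)) :
  induced_path (2 * n + 4) p ->
  exists s b c, s + n <= 2 * n + 4 /\
    ((forall i, i < n -> p (s + i) = (b, c + i)) \/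
     (forall i, i < n -> p (s + i) = (b, c + n.-1 - i))).
Proof.
move=> hp.
have padj i j : i < 2 * n + 4 -> j < 2 * n + 4 -> block_adj u (p i) (p j) = near i j.
  by move=> hi hj; have [_ h] := hp i j hi hj; apply/idP/idP => /h.
have [s [b [les hb]]] : exists s b, s + n <= 2 * n + 4 /\
    forall i, i < n -> (p (s + i)).1 = b.
  have [[i [lti hi]]|nobreak] :=
    pselect (exists i, i < n /\ (p i).1 <> (p i.+1).1).
    (* Indices from [n + 3] on are near neither [i] nor [i.+1], and a run of length [n] still
       fits. *)
    exists (n + 3), (p (n + 3)).1; split; first by lia.
    apply: (@locally_constant _ (fun i => (p i).1)) => j ltj; apply: contrapT => hj.
    have label k l : k < 2 * n + 4 -> l < 2 * n + 4 -> (p k).1 <> (p l).1 ->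
        u (p k).2 && u (p l).2 = near k l.
      by move=> hk hl /eqP/negbTE ne; rewrite -padj // /block_adj ne.
    have ui : u (p i).2 && u (p i.+1).2 by rewrite label /near; lia.
    have uj : u (p (n + 3 + j).+1).2 && u (p (n + 3 + j)).2.
      by rewrite label /near; lia.
    apply: hi; transitivity (p (n + 3 + j)).1; last apply: esym.
      by apply: contrapT => /label; rewrite /near; lia.
    by apply: contrapT => /label; rewrite /near; lia.
  exists 0, (p 0).1; split; first by lia.
  apply: (@locally_constant _ (fun i => (p i).1)) => i lti.
  by apply: contrapT => h; apply: nobreak; exists i; split; [lia | apply: nesym].
have sE i (lti : i < n) : p (s + i) = (b, (p (s + i)).2).
  by rewrite -(hb i lti); case: (p (s + i)).
have [| |c hc] := @near_monotone (fun i => (p (s + i)).2) n.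
- move=> i lti; have := padj (s + i) (s + i.+1).
  rewrite /block_adj !hb ?eqxx //; [|lia]; rewrite /near; lia.
- move=> i j lti ltj e.
  have [||inj _] := hp (s + i) (s + j); [lia | lia |].
  by apply/(@addnI s)/inj; rewrite sE // e -sE.
exists s, b, c; split=> //.
by case: hc => hc; [left|right] => i lti; rewrite sE // hc.
Qed.

Lemma word_graph_long_paths u : has_long_paths (word_graph u).
Proof.
apply/has_long_pathsP => n.
have /choice[p hp] : forall i, exists v : vertex (word_graph u),
    i < n -> sval v = (n, i).
  move=> i; have [lti|_] := ltnP i n; last by exists (exist _ (0, 0) isT).
  have hi : (n, i).2 < (n, i).1 + 6 by rewrite /=; lia.
  by exists (exist _ (n, i) hi).
exists p => i j lti ltj; rewrite /= !hp //= /block_adj /= eqxx; split=> //.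
by move/(congr1 sval); rewrite !hp // => -[].
Qed.

(** Block [n] is sent to a copy of its labelled path inside block [g n] of [A]; [g] increases
    strictly, so distinct blocks stay distinct. *)
Lemma word_graph_path_minimal x : path_minimal (word_graph (toeplitz x)).
Proof.
set u := toeplitz x; split; first exact: word_graph_long_paths.
move=> A /has_long_pathsP longA.
pose P n m := exists c, forall i, i < n + 6 -> u (c + i) = u i /\
  exists w : vertex (induced A), sval (sval w) = (m, c + i).
have [|g [gmono hg]] := @increasing_choice P.
  (* [2 ^ k.+1] makes the run contain the required prefix; the extra [N + 6] forces a block of index
     at least [N], as block [b] has only [b + 6] vertices. *)
  move=> n N; pose k := n + 7; pose W := 2 ^ k.+1 + N + 6.
  have [p hp] := longA (2 * W + 4).
  have emb := embedding_comp (embedding_induced A) (embedding_induced _).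
  have [s [b [c [les hrun]]]] := induced_path_run (induced_path_embedding emb hp).
  have inA i : i < W -> exists w : vertex (induced A), sval (sval w) = (b, c + i).
    move=> lti; case: hrun => hrun; first by exists (p (s + i)); apply: hrun.
    exists (p (s + (W.-1 - i))); rewrite [LHS]hrun; last by lia.
    by congr pair; lia.
  exists b.
    have [|w e] := inA W.-1; first by lia.
    by have := svalP (sval w); rewrite e /=; lia.
  have [t [ht1 ht2] htu] := toeplitz_recurrence x k c.
  have ltk : k < 2 ^ k by apply: ltn_expl.
  exists t => i lti; split; first by apply: htu; lia.
  have [|w hw] := inA (t - c + i); first by lia.
  by exists w; rewrite hw; congr pair; lia.
have ginj i j : g i = g j -> i = j.
  by move=> e; case: (ltngtP i j) => // /gmono; rewrite e ltnn.
have [c hc] := choice hg.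
have /choice[f hf] : forall v : vertex (word_graph u), exists w : vertex (induced A),
    sval (sval w) = (g (sval v).1, c (sval v).1 + (sval v).2).
  by move=> [[n i] /= lti]; have [_] := hc n i lti.
apply/embedsP; exists f; split.
  move=> v w e; apply: sval_injective.
  have := hf v; rewrite e hf => -[/ginj].
  by case: (sval v) (sval w) => [n i] [m j] /= -> /addnI ->.
move=> v w; rewrite /= !hf /block_adj /=.
have [hv _] := hc _ _ (svalP v); have [hw _] := hc _ _ (svalP w).
rewrite hv hw; case: (eqVneq (sval v).1 (sval w).1) => [->|ne].
  by rewrite !eqxx nearDl.
by rewrite ifN //; apply: contra ne => /eqP/ginj/eqP.
Qed.

(** A vertex adjacent to one member of a module but not to another belongs to it. Under this closure
    two members generate a block, and a block generates the whole graph. *)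
Lemma word_graph_prime u :
  (forall n, ~~ u n.*2) -> u 1 -> u 5 -> prime_graph (word_graph u).
Proof.
move=> ueven u1 u5; split.
  have h (n : nat) : (n, 0).2 < (n, 0).1 + 6 by rewrite /= addn_gt0 orbT.
  pose f (n : nat) : vertex (word_graph u) := exist _ (n, 0) (h n).
  have finj : injective f by move=> i j /(congr1 sval) [].
  apply: card_le_trans (subset_card_le (@subsetT _ (f @` `I_4))).
  have : f @` `I_4 #= `I_4 by apply: inj_card_eq => i j _ _; apply: finj.
  by rewrite card_eq_le => /andP[].
move=> A modA.
pose B (p : nat * nat) := exists h : p.2 < p.1 + 6, A (exist _ p h).
have Bdom p : B p -> p.2 < p.1 + 6 by case.
have Bsplit p q r : B p -> B q -> r.2 < r.1 + 6 ->
    block_adj u r p -> ~~ block_adj u r q -> B r.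
  move=> [hp Ap] [hq Aq] hr rp rq; exists hr; apply: contrapT => nAr.
  by have [/(_ _ Aq)/= h|/(_ _ Ap)] := modA _ nAr; [rewrite h in rq|].
have Bspread n i : B (n, i) -> B (n, i.+1) -> forall j, j < n + 6 -> B (n, j).
  move=> Bi Bi1.
  have up d : i + d.+1 < n + 6 -> B (n, i + d) /\ B (n, i + d.+1).
    elim: d => [|d IH] ltd; first by rewrite addn0 addn1.
    have [|h1 h2] := IH; first by lia.
    split=> //; apply: (Bsplit _ _ _ h2 h1) => //; rewrite /block_adj /= eqxx /near;
      lia.
  have down d : d <= i -> B (n, i - d) /\ B (n, (i - d).+1).
    elim: d => [|d IH] ltd; first by rewrite subn0.
    have [|h1 h2] := IH; first by lia.
    have -> : (i - d.+1).+1 = i - d by lia.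
    split=> //; have := Bdom _ h1 => /= ?.
    apply: (Bsplit _ _ _ h1 h2) => /=; rewrite /block_adj /= ?eqxx /near; lia.
  move=> j ltj; have [leji|ltij] := leqP j i.
    by have [|h _] := down (i - j); [lia | rewrite subKn in h].
  have -> : j = i + (j - i.+1).+1 by lia.
  by apply: (up _ _).2; lia.
have Bblock n i j : i < j -> B (n, i) -> B (n, j) ->
    forall k, k < n + 6 -> B (n, k).
  move=> ltij Bi Bj; have := Bdom _ Bj => /= ltj.
  (* At distance two, [i.+1] is adjacent to both; [i.-1] separates them instead, or position 3 when
     [i = 0]. *)
  have [e|ne] := eqVneq j i.+2.
    case: i => [|i] in e ltij Bi *.
      apply: (Bspread n 2); first by rewrite -e.
      subst j; apply: (Bsplit _ _ _ Bj Bi); rewrite /block_adj /= ?eqxx /near; lia.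
    apply: (Bspread n i) => //.
    subst j; apply: (Bsplit _ _ _ Bi Bj); rewrite /block_adj /= ?eqxx /near; lia.
  have [e1|ne1] := eqVneq j i.+1; first by apply: (Bspread n i) => //; rewrite -e1.
  apply: (Bspread n i) => //.
  by apply: (Bsplit _ _ _ Bi Bj); rewrite /block_adj /= ?eqxx /near; lia.
have Ball n : (forall k, k < n + 6 -> B (n, k)) -> forall p, p.2 < p.1 + 6 -> B p.
  move=> hn [m k] /= ltk; have [e|ne] := eqVneq m n; first by subst m; apply: hn.
  have u0 := ueven 0.
  (* Positions 1 and 0 of block [n] have labels 1 and 0, so every vertex labelled 1 elsewhere
     separates them. Each block has length at least 6, hence such vertices at 1 and 5. *)
  have Bone l : l < m + 6 -> u l -> B (m, l).
    move=> ltl ul; apply: (Bsplit (n, 1) (n, 0)) => //; try by apply: hn; lia.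
      by rewrite /block_adj /= ifN // ul.
    by rewrite /block_adj /= ifN // (negbTE u0) andbF.
  by apply: (Bblock m 1 5) ltk => //; apply: Bone => //; lia.
have Btwo p q : B p -> B q -> p <> q -> forall r, r.2 < r.1 + 6 -> B r.
  move: p q => [n i] [m j] Bp Bq ne.
  have [e|nm] := eqVneq n m.
    subst m; apply: Ball (n) _.
    by case: (ltngtP i j) => [h|h|e]; [exact: Bblock h Bp Bq | exact: Bblock h Bq Bp |];
      case: ne; rewrite e.
  have /= lti := Bdom _ Bp; have /= ltj := Bdom _ Bq.
  (* If [u j] holds, the vertex before [(m, j)] has label 0 and is not adjacent to [(n, i)];
     otherwise a neighbour of [(n, i)] in block [n] is not adjacent to [(m, j)]. *)
  case uj: (u j).
    have oddj : odd j.
      apply: contraLR uj => evj; have := ueven j./2.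
      by rewrite even_halfK.
    have uj1 : u j.-1 = false.
      apply/negbTE; have := ueven j./2; rewrite -[j in u j.-1](odd_double_half j).
      by rewrite oddj.
    have j0 : 0 < j by case: (j) oddj.
    apply: (Ball m); apply: (Bblock m j.-1 j); [lia| |by []].
    apply: (Bsplit _ _ _ Bq Bp) => /=; rewrite /block_adj /=; first by lia.
      by rewrite eqxx /near; lia.
    by rewrite ifN 1?eq_sym // uj1.
  pose i' := if i is k.+1 then k else 1.
  have hi' : near i' i && (i' < n + 6).
    by rewrite /i'; case: (i) lti => [|k] ?; rewrite /near; lia.
  have Bi' : B (n, i').
    apply: (Bsplit _ _ _ Bp Bq) => /=; rewrite /block_adj /=; first by lia.
      by rewrite eqxx; lia.
    by rewrite ifN // uj andbF.
  apply: (Ball n); have /andP[hnear _] := hi'.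
  case: (ltngtP i i') => [h|h|e]; [exact: Bblock h Bp Bi' | exact: Bblock h Bi' Bp |].
  by move: hnear; rewrite e /near; lia.
have [[v Av]|noA] := pselect (exists v, A v); last first.
  by constructor 1; apply/seteqP; split=> // v Av; apply: noA; exists v.
have [[w [Aw ne]]|single] := pselect (exists w, A w /\ w <> v); last first.
  constructor 2; exists v; apply/seteqP; split=> [w Aw /=|w -> //].
  by apply: contrapT => ne; apply: single; exists w.
constructor 3; apply/seteqP; split=> // r _.
have toB (z : vertex (word_graph u)) : A z -> B (sval z).
  by case: z => p hp Ap; exists hp.
have [|h Ar] := Btwo _ _ (toB v Av) (toB w Aw) _ (sval r) (svalP r).
  by move=> e; apply: ne; apply: sval_injective.
by have -> : r = exist _ (sval r) h by apply: sval_injective.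
Qed.

(** * Well-quasi-ordered ages *)

Definition in_interval (w : nat * nat) (i : nat) : bool := w.1 <= i < w.1 + w.2.

(* The nonempty intervals listed by [s] are the maximal intervals of [P]. *)
Definition interval_code (P : nat -> Prop) (s : seq (nat * nat)) : Prop :=
  (forall i, P i <-> exists2 t, t < size s & in_interval (nth (0, 0) s t) i) /\
  (forall t t' i j, t < size s -> t' < size s -> in_interval (nth (0, 0) s t) i ->
     in_interval (nth (0, 0) s t') j -> (i == j) || near i j -> t = t').

(** Induction on the bound: the maximal interval [[a, M]] ending at [M] is split off, and the rest
    of [P] stays below [a.-1]. *)
Lemma interval_code_exists (P : nat -> Prop) (M : nat) :
  (forall i, P i -> i < M) -> exists s, interval_code P s.
Proof.
have [n] := ubnP M; elim: n P M => // n IH P [|M] ltM hM.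
  exists [::]; split=> // i; split=> [/hM //|[]//].
have [PM|nPM] := pselect (P M); last first.
  apply: (IH P M) => // i Pi; have := hM i Pi; rewrite ltnS leq_eqVlt.
  by case/orP => // /eqP e; rewrite e in Pi.
pose R a := `[< forall i, a <= i <= M -> P i >].
have exR : exists a, R a.
  exists M; apply/asboolP => i hi; by have -> : i = M by lia.
case: (ex_minnP exR) => a /asboolP Ra amin.
have leaM : a <= M.
  by apply: amin; apply/asboolP => i hi; have -> : i = M by lia.
have hgap i : P i -> i < a -> i.+1 < a.
  move=> Pi lti; rewrite ltn_neqAle lti andbT; apply/eqP => e.
  suff : a <= i by lia.
  apply: amin; apply/asboolP => j hj; have [->//|ne] := eqVneq j i.
  by apply: Ra; lia.
have [||s [sP ssep]] := IH (fun i => P i /\ i.+1 < a) a.-1.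
- by lia.
- by move=> i []; lia.
exists ((a, M.+1 - a) :: s); split=> [i|].
  split=> [Pi|[[|t]/= ltt]].
  - have [leai|ltia] := leqP a i.
      by exists 0 => //; rewrite /in_interval /=; have := hM i Pi; lia.
    have /sP[t ltt int] : P i /\ i.+1 < a by split=> //; apply: hgap.
    by exists t.+1.
  - by rewrite /in_interval /= => hi; apply: Ra; lia.
  - by move=> hi; have /sP[] : exists2 t, t < size s & in_interval (nth (0, 0) s t) i
      by exists t.
have sa t i : t < size s -> in_interval (nth (0, 0) s t) i -> i.+1 < a.
  by move=> ltt hi; have /sP[] : exists2 t, t < size s & in_interval (nth (0, 0) s t) i
      by exists t.
move=> [|t] [|t'] i j //= ltt ltt' hi hj hij.
- by have := sa _ _ ltt' hj; move: hi hij; rewrite /in_interval /near /=; lia.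
- by have := sa _ _ ltt hi; move: hj hij; rewrite /in_interval /near /=; lia.
- by congr S; apply: (ssep t t' i j).
Qed.

Definition block_code (P : nat * nat -> Prop) (C : seq (seq (nat * nat))) : Prop :=
  (forall p, P p -> p.1 < size C) /\
  forall b, b < size C -> interval_code (fun i => P (b, i)) (nth [::] C b).

Lemma block_code_exists (P : nat * nat -> Prop) :
  finite_set P -> exists C, block_code P C.
Proof.
move=> /finite_seqP[s PE].
pose M := (\max_(p <- s) (p.1 + p.2)).+1.
have hM p : P p -> p.1 + p.2 < M.
  by rewrite PE /= ltnS => ps; exact: (@leq_bigmax_seq _ s xpredT (fun p => p.1 + p.2) p ps isT).
have /choice[c hc] : forall b, exists s, interval_code (fun i => P (b, i)) s.
  move=> b; apply: (@interval_code_exists _ M) => i /hM /=; lia.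
exists (mkseq c M); split=> [p /hM|b]; rewrite size_mkseq; first by lia.
by move=> ltb; rewrite nth_mkseq.
Qed.

(** [phi] moves blocks, [psi] moves intervals within a block, [off] shifts an interval inside its
    target. Labels are kept because factors agree, and non-adjacency within a block because distinct
    maximal intervals are separated. *)
Lemma block_code_le u (P Q : nat * nat -> Prop) C D :
  block_code P C -> block_code Q D ->
  seq_le [::] (seq_le (0, 0) (factor_le u)) C D ->
  exists f : nat * nat -> nat * nat, (forall p, P p -> Q (f p)) /\
    forall p q, P p -> P q ->
      (f p = f q -> p = q) /\ block_adj u (f p) (f q) = block_adj u p q.
Proof.
move=> [Cdom Ccode] [Ddom Dcode] [phi [hphi phiinj]].
have /choice[psi hpsi] : forall b, exists psi : nat -> nat, b < size C ->
    (forall t, t < size (nth [::] C b) -> psi t < size (nth [::] D (phi b)) /\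
      factor_le u (nth (0, 0) (nth [::] C b) t)
                  (nth (0, 0) (nth [::] D (phi b)) (psi t))) /\
    (forall t t', t < size (nth [::] C b) -> t' < size (nth [::] C b) ->
       psi t = psi t' -> t = t').
  move=> b; have [/hphi[_ [psi hpsi]]|_] := ltnP b (size C); last by exists id.
  by exists psi.
pose cw b t := nth (0, 0) (nth [::] C b) t.
pose dw b t := nth (0, 0) (nth [::] D (phi b)) (psi b t).
have /choice[off hoff] : forall bt : nat * nat, exists o,
    bt.1 < size C -> bt.2 < size (nth [::] C bt.1) ->
    o + (cw bt.1 bt.2).2 <= (dw bt.1 bt.2).2 /\ forall i, i < (cw bt.1 bt.2).2 ->
      u ((cw bt.1 bt.2).1 + i) = u ((dw bt.1 bt.2).1 + o + i).
  move=> [b t] /=; have [ltb|_] := ltnP b (size C); last by exists 0.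
  have [ltt|_] := ltnP t (size (nth [::] C b)); last by exists 0.
  by have [_ [o h1 h2]] := (hpsi b ltb).1 t ltt; exists o.
have /choice[tt htt] : forall p : nat * nat, exists t,
    P p -> t < size (nth [::] C p.1) /\ in_interval (cw p.1 t) p.2.
  move=> [b i] /=; have [Pp|] := pselect (P (b, i)); last by exists 0.
  by have /(Ccode b (Cdom _ Pp)).1[t] := Pp; exists t.
pose f (p : nat * nat) := (phi p.1,
  (dw p.1 (tt p)).1 + off (p.1, tt p) + (p.2 - (cw p.1 (tt p)).1)).
have fP p : P p -> [/\ psi p.1 (tt p) < size (nth [::] D (phi p.1)),
    in_interval (dw p.1 (tt p)) (f p).2 & u (f p).2 = u p.2].
  move=> Pp; have ltb := Cdom _ Pp; have [ltt hi] := htt _ Pp.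
  have [ho hu] := hoff (p.1, tt p) ltb ltt; rewrite /= in ho hu.
  split; first exact: ((hpsi _ ltb).1 _ ltt).1.
    by move: hi ho; rewrite /in_interval /=; lia.
  rewrite /= -hu; last by move: hi; rewrite /in_interval; lia.
  by congr u; move: hi; rewrite /in_interval; lia.
(* Equal or near positions of one block, before or after [f], share a maximal interval; both codes
   and the injectivity of [psi] are used. *)
have fsame p q : P p -> P q -> p.1 = q.1 ->
    ((f p).2 == (f q).2) || near (f p).2 (f q).2 || (p.2 == q.2) || near p.2 q.2 ->
    tt p = tt q.
  move=> Pp Pq e h; have ltb := Cdom _ Pp; have [ltt hi] := htt _ Pp.
  have [ltt' hi'] := htt _ Pq; have [h1 h2 _] := fP _ Pp; have [h1' h2' _] := fP _ Pq.
  rewrite -e in ltt' hi' h1' h2'.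
  have [hF|hnF] := boolP (((f p).2 == (f q).2) || near (f p).2 (f q).2).
    apply: (hpsi _ ltb).2 => //.
    exact: (Dcode _ (hphi _ ltb).1).2 h1 h1' h2 h2' hF.
  apply: (Ccode _ ltb).2 ltt ltt' hi hi' _.
  by move: h; rewrite -orbA (negbTE hnF).
have fshift p q : P p -> P q -> p.1 = q.1 -> tt p = tt q ->
    ((f p).2 == (f q).2) = (p.2 == q.2) /\ near (f p).2 (f q).2 = near p.2 q.2.
  move=> Pp Pq e et; have [_ hi] := htt _ Pp; have [_ hi'] := htt _ Pq.
  move: hi hi'; rewrite /f /= -e -et /in_interval => hi hi'.
  rewrite nearDl eqn_add2l -(nearDl (cw p.1 (tt p)).1).
  rewrite -(eqn_add2l (cw p.1 (tt p)).1) !subnKC //; [by case/andP: hi' | by case/andP: hi].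
exists f; split=> [p Pp|p q Pp Pq].
  have ltb := Cdom _ Pp; have [h1 h2 _] := fP p Pp.
  by apply/(Dcode _ (hphi _ ltb).1).1; exists (psi p.1 (tt p)).
split.
  move=> ef; have e1 : p.1 = q.1.
    by apply: phiinj; rewrite ?Cdom //; apply: (congr1 fst ef).
  have et : tt p = tt q by apply: fsame => //; rewrite ef eqxx.
  have [] := fshift p q Pp Pq e1 et; rewrite ef eqxx => /esym/eqP e2 _.
  by rewrite (surjective_pairing p) (surjective_pairing q) e1 e2.
rewrite /block_adj; have [_ _ ->] := fP p Pp; have [_ _ ->] := fP q Pq.
have [e|ne] := eqVneq p.1 q.1.
  have -> : (f p).1 == (f q).1 by rewrite /= e.
  have [et|net] := eqVneq (tt p) (tt q); first by case: (fshift p q Pp Pq e et).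
  have := contra_neqN (fsame p q Pp Pq e) net.
  by rewrite 3!negb_or => /andP[/andP[/andP[_ /negbTE ->] _] /negbTE ->].
by rewrite ifN //; apply: contra ne => /eqP/phiinj e; apply/eqP/e; rewrite Cdom.
Qed.

Lemma word_graph_wqo x : wqo (age (word_graph (toeplitz x))).
Proof.
set u := toeplitz x => -[F [ageF antiF]].
pose spec n C (e : vertex (F n) -> vertex (block_graph u)) :=
  embedding e /\ block_code (range e) C.
have /choice[C hC] : forall n, exists C, exists e, @spec n C e.
  move=> n; have [finF /embedsP[e he]] := ageF n.
  have emb := embedding_comp he (embedding_induced _).
  have [C hC] := block_code_exists (finite_image (fun v => sval (e v)) finF).
  by exists C, (fun v => sval (e v)).
have good2 : good (seq_le [::] (seq_le (0, 0) (factor_le u))).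
  apply: higman; last exact/seq_le_trans/factor_le_trans.
  by apply: higman; [exact: factor_le_good | exact: factor_le_trans].
have [i [j [ltij leC]]] := good2 C.
have [ei [[eiinj eiadj] codei]] := hC i; have [ej [[ejinj ejadj] codej]] := hC j.
have [f [fdom fadj]] := block_code_le codei codej leC.
apply: (antiF i j); first by move=> e; rewrite e ltnn in ltij.
apply/embedsP.
have /choice[g hg] : forall v, exists w, ej w = f (ei v).
  by move=> v; have [w _ <-] := fdom _ (imageT ei v); exists w.
exists g; split=> [v w e|v w].
  by apply/eiinj/(fadj _ _ (imageT ei v) (imageT ei w)).1; rewrite -!hg e.
rewrite ejadj !hg eiadj /=.
by rewrite (fadj _ _ (imageT ei v) (imageT ei w)).2.
Qed.

(** * Incomparable ages *)

(* The edges between the two paths force the long runs given by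
   [induced_path_run] into different blocks, where they reveal the labels. *)
Lemma labels_recovered (u v : nat -> bool) n (p q : nat -> vertex (block_graph v)) :
  induced_path (2 * n + 4) p -> induced_path (2 * n + 4) q ->
  (forall i j, i < 2 * n + 4 -> j < 2 * n + 4 ->
     block_adj v (p i) (q j) = u i && u j) ->
  (forall s, exists i j, [/\ i < j, j < n, u (s + i) & u (s + j)]) ->
  exists s c, (forall i, i < n -> u (s + i) = v (c + i)) \/
              (forall i, i < n -> u (s + i) = v (c + n.-1 - i)).
Proof.
move=> hp hq pq ones2.
have [s [b [c [les hrun]]]] := induced_path_run hp.
have [s' [b' [c' [les' hrun']]]] := induced_path_run hq.
have [i1 [i2 [lti lti2 ui1 ui2]]] := ones2 s.
have [j1 [j2 [ltj ltj2 uj1 uj2]]] := ones2 s'.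
have pE i : i < n -> (p (s + i)).1 = b.
  by move=> h; case: hrun => ->.
have qE i : i < n -> (q (s' + i)).1 = b'.
  by move=> h; case: hrun' => ->.
have adj1 i j : i < n -> j < n ->
    block_adj v (p (s + i)) (q (s' + j)) = u (s + i) && u (s' + j).
  by move=> hi hj; apply: pq; lia.
(* In a common block, two ones from each run would form a 4-cycle inside a path. *)
have bb' : b != b'.
  apply/eqP => e.
  have nearpq i j : i < n -> j < n -> u (s + i) -> u (s' + j) ->
      near (p (s + i)).2 (q (s' + j)).2.
    move=> hi hj ui uj; have := adj1 i j hi hj.
    by rewrite /block_adj pE // qE // e eqxx ui uj.
  have := nearpq i1 j1; have := nearpq i1 j2; have := nearpq i2 j1; have := nearpq i2 j2.
  have : (p (s + i1)).2 <> (p (s + i2)).2 by case: hrun => h; rewrite !h /=; lia.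
  have : (q (s' + j1)).2 <> (q (s' + j2)).2 by case: hrun' => h; rewrite !h /=; lia.
  by rewrite /near; lia.
have label i j : i < n -> j < n ->
    v (p (s + i)).2 && v (q (s' + j)).2 = u (s + i) && u (s' + j).
  by move=> hi hj; rewrite -adj1 // /block_adj pE // qE // ifN.
have vj1 : v (q (s' + j1)).2.
  by have := label i1 j1; rewrite ui1 uj1; case: (v (q _).2) => //; rewrite andbF; lia.
have uE i : i < n -> u (s + i) = v (p (s + i)).2.
  by move=> hi; have := label i j1 hi; rewrite uj1 vj1 !andbT => ->; lia.
exists s, c; case: hrun => hrun; [left|right] => i hi; by rewrite uE // hrun.
Qed.

Lemma word_graph_age_not_sub (x y : nat -> bool) k :
  (forall i, i < k -> x i = y i) -> x k <> y k -> ~~ x k.+1 -> ~~ y k.+1 -> x 1 ->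
  ~ (age (word_graph (toeplitz x)) `<=` age (word_graph (toeplitz y))).
Proof.
move=> xy xyk xk1 yk1 x1; set u := toeplitz x; set v := toeplitz y => hsub.
pose n := 2 ^ (k + 3); pose M := 2 * n + 4.
have n8 : 8 <= n by rewrite /n expnD leq_pmull // expn_gt0.
(* The first [M] vertices of blocks [M] and [M.+1] serve as the two paths. *)
pose H := @induced (word_graph u) [set w | (sval w).1 < M + 2].
have finH : finite_graph H.
  pose e (w : vertex H) : nat * nat := sval (sval w).
  have einj : injective e by move=> w w' /sval_injective /sval_injective.
  rewrite /finite_graph; have /eq_finite_set <- : e @` [set: vertex H] #= [set: vertex H].
    by apply: inj_card_eq => w w' _ _; apply: einj.
  apply: (sub_finite_set _ (finite_setX (finite_II (M + 2)) (finite_II (M + 8)))).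
  move=> _ [w _ <-]; split=> /=; first exact: (svalP w).
  by have := svalP w; have := svalP (sval w); rewrite /e /=; lia.
have [_ /embedsP[e he]] : age (word_graph v) H.
  by apply: hsub; split=> //; apply/embedsP; eexists; apply: embedding_induced.
have [einj eadj] := embedding_comp he (embedding_induced _).
have /choice[h hh] : forall ai : nat * nat, exists w : vertex H,
    ai.1 < 2 -> ai.2 < M -> sval (sval w) = (M + ai.1, ai.2).
  have hM a i : a < 2 -> i < M -> exists w : vertex H, sval (sval w) = (M + a, i).
    move=> lta lti; have h1 : (M + a, i).2 < (M + a, i).1 + 6 by rewrite /=; lia.
    have h2 : (M + a, i).1 < M + 2 by rewrite /= ltn_add2l.
    by exists (exist _ (exist _ (M + a, i) h1) h2).
  have [w0 _] : exists w : vertex H, sval (sval w) = (M + 0, 0) by apply: hM; lia.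
  move=> [a i] /=; have [lta|_] := ltnP a 2; last by exists w0.
  have [lti|_] := ltnP i M; last by exists w0.
  by have [w hw] := hM a i lta lti; exists w.
pose p a i := (sval (e (h (a, i))) : vertex (block_graph v)).
have padj a a' i j : a < 2 -> a' < 2 -> i < M -> j < M ->
    block_adj v (p a i) (p a' j) = block_adj u (M + a, i) (M + a', j).
  move=> ha ha' hi hj; have := eadj (h (a, i)) (h (a', j)).
  by rewrite /= !hh // => -[h1 h2]; apply/idP/idP.
have ppath a : a < 2 -> induced_path M (p a).
  move=> ha i j hi hj; split.
    by move=> /einj /(congr1 (fun w => sval (sval w))); rewrite !hh // => -[].
  by rewrite /= padj // /block_adj /= eqxx.
have [i j hi hj|s|s [c hsc]] :=
    @labels_recovered u v n (p 0) (p 1) (ppath 0 isT) (ppath 1 isT).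
- by rewrite padj // /block_adj /= addn0 ifN //; lia.
(* Since [x 1] holds, all positions congruent to 1 modulo 4 carry ones; the first two from [s] on
   lie within [8 <= n] places. *)
- have u1 a : u (a.*2.*2.+1) by rewrite /u toeplitz_odd toeplitz_even.
  pose a := (s + 2) %/ 4.
  exists (a.*2.*2.+1 - s), (a.+1.*2.*2.+1 - s).
  have ha : s <= a.*2.*2.+1 /\ a.*2.*2.+1 < s + 4 by rewrite /a; lia.
  rewrite !subnKC ?u1; [|lia|lia]; split=> //; lia.
apply: (@toeplitz_ones_inj x y k s c xy xyk xk1 yk1); rewrite -/n.
case: hsc => hsc; last rewrite -(ones_rev v); apply: eq_bigr => i _;
  by congr nat_of_bool; apply: hsc.
Qed.

(** Membership of [i] is stored at the odd place [2 i + 3], and every even place is 0, so a place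
    where two sequences differ is followed by 0 in both. *)
Definition digits (b : set nat) (n : nat) : bool :=
  match n with 0 => false | 1 => true | m.+2 => odd m && `[< b m./2 >] end.

Lemma digits_age (b b' : set nat) : b <> b' ->
  ~ (age (word_graph (toeplitz (digits b))) `<=`
     age (word_graph (toeplitz (digits b')))).
Proof.
move=> ne.
have exk : exists k, digits b k != digits b' k.
  apply: contrapT => hno; apply: ne; apply/seteqP.
  have e i : digits b i.*2.+3 = digits b' i.*2.+3.
    by apply/eqP; apply: contrapT => /negP h; apply: hno; exists i.*2.+3.
  have {}e i : `[< b i >] = `[< b' i >].
    by have := e i; rewrite /= odd_double uphalf_double.
  by split=> i /asboolP; [rewrite e | rewrite -e] => /asboolP.
case: (ex_minnP exk) => k /eqP hk kmin.
have hk1 c : ~~ digits c k.+1.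
  by move: hk; case: (k) => [|[|m]] //=; case: (odd m).
apply: (@word_graph_age_not_sub _ _ k) => // i lti.
by apply/eqP; apply: contraTT lti => /kmin; rewrite -leqNgt.
Qed.

Theorem theorem10 :
  exists S : set graph,
    [/\ S #= [set: set nat],
        forall G, S G -> [/\ path_minimal G, prime_graph G & wqo (age G)] &
        forall G H, S G -> S H -> G <> H ->
          ~ (age G `<=` age H) /\ ~ (age H `<=` age G)].
Proof.
pose gr (b : set nat) := word_graph (toeplitz (digits b)).
exists (range gr); split.
(* Distinct sets give distinct graphs because equal graphs would have equal ages. *)
- apply: inj_card_eq => b b' _ _ e; apply: contrapT => /digits_age; apply.
  by rewrite -/(gr b) e.
- move=> _ [b _ <-]; split; first exact: word_graph_path_minimal.
    apply: word_graph_prime => [n| |]; first by rewrite toeplitz_even.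
      by rewrite (toeplitz_odd _ 0) (toeplitz_even _ 0).
    by rewrite (toeplitz_odd _ 2) (toeplitz_even _ 1).
  exact: word_graph_wqo.
- move=> _ _ [b _ <-] [b' _ <-] ne.
  have bb' : b <> b' by move=> e; apply: ne; rewrite e.
  by split; apply: digits_age => // e; apply: bb'.
Qed.
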